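(* Let $c\in\mathbb{R}$, let $I_c=[0,-1/c]$ if $c<0$ and $I_c=[0,+\infty)$ if $c\geq0$, and let $n>0$ be real with $n>c$ if $c\geq 0$, or $n=-cl$ for some $l\in\mathbb{N}$ if $c<0$. For $k\in\mathbb{N}_0$, $x\in I_c$ let $$p_{n,k}^{[c]}(x)=(-1)^k\binom{-n/c}{k}(cx)^k(1+cx)^{-\frac{n}{c}-k}\ (c\neq0),\qquad p_{n,k}^{[0]}(x)=\frac{(nx)^k}{k!}e^{-nx},$$ let $S_{n,c}(x)=\sum_{k=0}^\infty\big(p_{n,k}^{[c]}(x)\big)^2$ and let $R_{n,c}(x)=-\log S_{n,c}(x)$ (Rényi entropy of order 2). Then: (i) for $c\geq 0$, $R_{n,c}$ is concave and increasing on $[0,+\infty)$; (ii) for every $c\in\mathbb{R}$, $u=R_{n,c}'$ satisfies on $I_c$ the Riccati equation $$x(1+cx)(1+2cx)u'(x)=x(1+cx)(1+2cx)u^2(x)-\big(4(n+c)x(1+cx)+1\big)u(x)+2n(1+2cx).$$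
   Context: For $\alpha\in\mathbb{R}$ and $k\in\mathbb{N}$, $\binom{\alpha}{k}=\frac{\alpha(\alpha-1)\cdots(\alpha-k+1)}{k!}$ and $\binom{\alpha}{0}=1$. The cases $c=-1,0,1$ give the binomial, Poisson and negative binomial distributions. *)

(* Defs.v *)
From Stdlib Require Import Reals Factorial.
From Coquelicot Require Import Coquelicot.
Open Scope R_scope.

Fixpoint gbinom (a : R) (k : nat) : R :=
  match k with
  | O => 1
  | S k' => gbinom a k' * (a - INR k') / INR (S k')
  end.

(* Real power b^e.  For b > 0 this is exp(e ln b).  The only non-positive base
   occurring on I_c is b = 1 + c x = 0 at x = -1/c (c < 0), where the exponent
   is an integer l - k; there 0^0 = 1 and 0^e = 0 for e > 0 (negative exponents
   only occur multiplied by a vanishing binomial coefficient). *)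
Definition gpow (b e : R) : R :=
  if Rlt_dec 0 b then Rpower b e
  else if Req_EM_T e 0 then 1 else 0.

Definition pnk (n c : R) (k : nat) (x : R) : R :=
  if Req_EM_T c 0 then (n * x) ^ k / INR (Factorial.fact k) * exp (- n * x)
  else (-1) ^ k * gbinom (- n / c) k * (c * x) ^ k * gpow (1 + c * x) (- n / c - INR k).

Definition Snc (n c x : R) : R := Series (fun k => (pnk n c k x) ^ 2).

Definition Rnc (n c x : R) : R := - ln (Snc n c x).

Definition Ic (c x : R) : Prop := 0 <= x /\ (c < 0 -> x <= - 1 / c).

Definition admissible (n c : R) : Prop :=
  0 < n /\ (0 <= c -> c < n) /\ (c < 0 -> exists l : nat, n = - c * INR l).

Definition is_derive_within (D : R -> Prop) (f : R -> R) (x l : R) : Prop :=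
  filterlim (fun h => (f (x + h) - f x) / h)
    (within (fun h => h <> 0 /\ D (x + h)) (locally 0)) (locally l).

(* Main.v *)
(** With [t = (x / (1 + c x))^2] one has, for every [c], [S = G(x) F(t)], where
    [G = (1 + c x)^(-2n/c)] ([exp (- 2 n x)] if [c = 0]) and [F = sum a_k t^k] with
    [(k + 1)^2 a_(k+1) = (n + c k)^2 a_k].  The recurrence is the hypergeometric equation
    [t (1 - c^2 t) F'' + (1 - (c^2 + 2 n c) t) F' - n^2 F = 0], which becomes
    [x (1 + c x) (1 + 2 c x) S'' + (4 (n + c) x (1 + c x) + 1) S' + 2 n (1 + 2 c x) S = 0];
    the Riccati equation is this one rewritten for [u = - S' / S].  If [c < 0], [S] is a
    polynomial on [I_c] and the end point [- 1 / c] is reached by continuity.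

    For [c >= 0], concavity and monotonicity follow from the Riccati equation
    [p u' = p u^2 - q u + r] alone, by comparison from the singular point [0], where [u = 2 n] and
    [u' = - 2 n (n + c)]: [u] cannot vanish since [r > 0]; the function [2 n / (1 + 2 c x)] is a
    supersolution because [c < n], so [u] stays below it, hence below the larger root of
    [p z^2 - q z + r]; and [u] cannot cross the smaller root, because that root is decreasing
    while [u' = 0] at a crossing. *)
Require Import Defs.
From Stdlib Require Import Reals Factorial Lra Lia.
From Coquelicot Require Import Coquelicot.
Open Scope R_scope.

(** * Coefficients of [pnk] and factorisation of its square *)

(** The product [n (n + c) ... (n + (k - 1) c) / k!] absorbs the sign and the power of [c] into the
    binomial coefficient. No division by [c] remains, so the Poisson case is the value at
    [c = 0]. *)
Fixpoint rcoef (n c : R) (k : nat) : R :=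
  match k with
  | O => 1
  | S j => rcoef n c j * (n + c * INR j) / INR (S j)
  end.

Lemma INR_S_neq_0 (k : nat) : INR (S k) <> 0.
Proof. apply not_0_INR; lia. Qed.

Lemma rcoef_gbinom (n c : R) (k : nat) :
  c <> 0 -> rcoef n c k = gbinom (- n / c) k * (- c) ^ k.
Proof.
intros Hc; induction k as [|k IH].
- simpl; ring.
- change (rcoef n c (S k)) with (rcoef n c k * (n + c * INR k) / INR (S k)).
  change (gbinom (- n / c) (S k)) with
    (gbinom (- n / c) k * (- n / c - INR k) / INR (S k)).
  rewrite IH; change ((- c) ^ S k) with (- c * (- c) ^ k).
  field; split; [exact Hc | apply INR_S_neq_0].
Qed.

Lemma rcoef_poisson (n : R) (k : nat) : rcoef n 0 k = n ^ k / INR (fact k).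
Proof.
induction k as [|k IH].
- simpl; field.
- change (rcoef n 0 (S k)) with (rcoef n 0 k * (n + 0 * INR k) / INR (S k)).
  rewrite IH, fact_simpl, mult_INR; change (n ^ S k) with (n * n ^ k).
  field; split; [apply INR_fact_neq_0 | apply INR_S_neq_0].
Qed.

Lemma pnk_rcoef (n c : R) (k : nat) (x : R) :
  c <> 0 ->
  pnk n c k x = rcoef n c k * x ^ k * gpow (1 + c * x) (- n / c - INR k).
Proof.
intros Hc; unfold pnk; destruct (Req_EM_T c 0) as [H | _]; [easy |].
rewrite (rcoef_gbinom n c k Hc), Rpow_mult_distr.
replace ((- c) ^ k) with ((-1) ^ k * c ^ k)
  by (rewrite <- Rpow_mult_distr; f_equal; ring).
ring.
Qed.

(** Being an exponential in both branches, it is positive for every [x], even where [1 + c * x] is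
    not. *)
Definition weight (n c x : R) : R :=
  if Req_EM_T c 0 then exp (- 2 * n * x) else exp (- 2 * n / c * ln (1 + c * x)).

Lemma weight_pos (n c x : R) : 0 < weight n c x.
Proof. unfold weight; destruct (Req_EM_T c 0); apply exp_pos. Qed.

Lemma weight_0 (n c : R) : weight n c 0 = 1.
Proof.
unfold weight; destruct (Req_EM_T c 0);
  rewrite ?Rmult_0_r, ?Rplus_0_r, ?ln_1, ?Rmult_0_r; apply exp_0.
Qed.

(** The logarithmic derivative has the same form in both branches; later differentiations need no
    case split on [c]. *)
Lemma is_derive_weight (n c x : R) :
  0 < 1 + c * x ->
  is_derive (weight n c) x (- 2 * n / (1 + c * x) * weight n c x).
Proof.
intros Hx; unfold weight; destruct (Req_EM_T c 0) as [-> | Hc].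
- auto_derive; [easy | field; lra].
- auto_derive; [lra | field; lra].
Qed.

(** The exponent [- n / c - k] splits: the part free of [k] squares to the weight, and
    [(1 + c x)^(-k)] joins [x^k]. *)
Lemma pnk_sqr (n c : R) (k : nat) (x : R) :
  0 < 1 + c * x ->
  pnk n c k x ^ 2 =
  weight n c x * (rcoef n c k ^ 2 * ((x / (1 + c * x)) ^ 2) ^ k).
Proof.
intros Hx.
rewrite <- pow_mult, (Nat.mul_comm 2 k), pow_mult.
destruct (Req_EM_T c 0) as [-> | Hc].
- unfold pnk, weight; destruct (Req_EM_T 0 0) as [_ | H]; [| easy].
  rewrite rcoef_poisson, (Rpow_mult_distr n x k).
  replace (- 2 * n * x) with (- n * x + - n * x) by ring.
  rewrite exp_plus.
  replace (x / (1 + 0 * x)) with x by (field; lra).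
  field; apply INR_fact_neq_0.
- rewrite (pnk_rcoef n c k x Hc); unfold weight, gpow.
  destruct (Req_EM_T c 0) as [H | _]; [easy |].
  destruct (Rlt_dec 0 (1 + c * x)) as [_ | H]; [| easy].
  unfold Rminus; rewrite Rpower_plus, Rpower_Ropp, Rpower_pow by exact Hx.
  replace (- 2 * n / c * ln (1 + c * x))
    with (- n / c * ln (1 + c * x) + - n / c * ln (1 + c * x)) by (field; exact Hc).
  rewrite exp_plus; replace ((x / (1 + c * x)) ^ k) with (x ^ k * / (1 + c * x) ^ k)
    by (unfold Rdiv; now rewrite Rpow_mult_distr, pow_inv).
  unfold Rpower; field; apply pow_nonzero; lra.
Qed.

(** * Squared coefficients and the hypergeometric equation *)

Definition sqcoef (n c : R) (k : nat) : R := rcoef n c k ^ 2.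

Lemma sqcoef_S (n c : R) (k : nat) :
  INR (S k) ^ 2 * sqcoef n c (S k) = (n + c * INR k) ^ 2 * sqcoef n c k.
Proof.
unfold sqcoef; change (rcoef n c (S k)) with (rcoef n c k * (n + c * INR k) / INR (S k)).
field; apply INR_S_neq_0.
Qed.

Lemma Snc_weight (n c x : R) :
  0 < 1 + c * x ->
  Snc n c x = weight n c x * PSeries (sqcoef n c) ((x / (1 + c * x)) ^ 2).
Proof.
intros Hx; unfold Snc, PSeries; rewrite <- Series_scal_l.
apply Series_ext; intros k; now apply pnk_sqr.
Qed.

(** In the coefficient of [t^k], the terms in [a_(k+1)] add up to [k (k + 1) + (k + 1) = (k + 1)^2],
    and those in [a_k] to [- c^2 k (k - 1) - (c^2 + 2 n c) k - n^2 = - (n + c k)^2]; [sqcoef_S]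
    makes them cancel. *)
Lemma PSeries_sqcoef_ode (n c t : R) :
  Rbar_lt (Rabs t) (CV_radius (sqcoef n c)) ->
  t * (1 - c ^ 2 * t) * PSeries (PS_derive (PS_derive (sqcoef n c))) t
  + (1 - (c ^ 2 + 2 * n * c) * t) * PSeries (PS_derive (sqcoef n c)) t
  - n ^ 2 * PSeries (sqcoef n c) t = 0.
Proof.
intros Ht; set (a := sqcoef n c).
assert (H0 : is_pseries a t (PSeries a t))
  by (apply PSeries_correct, CV_radius_inside; exact Ht).
assert (H1 : is_pseries (PS_derive a) t (PSeries (PS_derive a) t))
  by (apply PSeries_correct, CV_radius_inside; rewrite CV_radius_derive; exact Ht).
assert (H2 : is_pseries (PS_derive (PS_derive a)) t (PSeries (PS_derive (PS_derive a)) t))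
  by (apply PSeries_correct, CV_radius_inside; rewrite !CV_radius_derive; exact Ht).
set (F := PSeries a t) in *; set (F1 := PSeries (PS_derive a) t) in *.
set (F2 := PSeries (PS_derive (PS_derive a)) t) in *.
pose proof (is_pseries_incr_1 _ _ _ H2) as H3.
pose proof (is_pseries_scal (- c ^ 2) _ _ _ (Rmult_comm _ _) (is_pseries_incr_1 _ _ _ H3)) as H4.
pose proof (is_pseries_scal (- (c ^ 2 + 2 * n * c)) _ _ _ (Rmult_comm _ _)
  (is_pseries_incr_1 _ _ _ H1)) as H5.
pose proof (is_pseries_scal (- n ^ 2) _ _ _ (Rmult_comm _ _) H0) as H6.
pose proof (is_pseries_plus _ _ _ _ _ (is_pseries_plus _ _ _ _ _ H3 H4)
  (is_pseries_plus _ _ _ _ _ H1 (is_pseries_plus _ _ _ _ _ H5 H6))) as H.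
apply is_pseries_unique in H.
rewrite (PSeries_ext _ (fun _ => 0)), PSeries_const_0 in H.
- unfold plus, scal, mult in H; simpl in H; unfold mult in H; simpl in H; lra.
- clear H; intros k; unfold PS_plus, PS_scal, PS_incr_1, PS_derive, plus, scal, mult, zero.
  pose proof (sqcoef_S n c k) as Hk; fold a in Hk.
  (* [t^2 F''] is a double index shift, each shift defined by cases, so the indices 0 and 1 are
     separate. *)
  destruct k as [|[|k]]; simpl in Hk |- *; unfold mult; simpl; nra.
Qed.

(** On [1 + c x > 0], [Ssum] is a closed form of [Snc], with derivatives [dSsum] and [ddSsum]. *)
Definition Ssum (n c x : R) : R :=
  weight n c x * PSeries (sqcoef n c) ((x / (1 + c * x)) ^ 2).

Definition dSsum (n c x : R) : R :=
  let b := 1 + c * x in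
  let t := (x / b) ^ 2 in
  weight n c x *
  (- 2 * n / b * PSeries (sqcoef n c) t
   + 2 * x / b ^ 3 * PSeries (PS_derive (sqcoef n c)) t).

Definition ddSsum (n c x : R) : R :=
  let b := 1 + c * x in
  let t := (x / b) ^ 2 in
  weight n c x *
  (2 * n * (2 * n + c) / b ^ 2 * PSeries (sqcoef n c) t
   + (2 / b ^ 3 - (6 * c + 8 * n) * x / b ^ 4) * PSeries (PS_derive (sqcoef n c)) t
   + (2 * x / b ^ 3) ^ 2 * PSeries (PS_derive (PS_derive (sqcoef n c))) t).

(** * Derivatives of the closed form and the linear equation *)

Lemma is_derive_sqr_ratio (c x : R) :
  1 + c * x <> 0 ->
  is_derive (fun y => (y / (1 + c * y)) ^ 2) x (2 * x / (1 + c * x) ^ 3).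
Proof. intros Hx; auto_derive; [exact Hx | field; exact Hx]. Qed.

Lemma is_derive_PSeries_sqr_ratio (a : nat -> R) (c x : R) :
  1 + c * x <> 0 ->
  Rbar_lt (Rabs ((x / (1 + c * x)) ^ 2)) (CV_radius a) ->
  is_derive (fun y => PSeries a ((y / (1 + c * y)) ^ 2)) x
    (2 * x / (1 + c * x) ^ 3 * PSeries (PS_derive a) ((x / (1 + c * x)) ^ 2)).
Proof.
intros Hx Ha.
apply (is_derive_comp (PSeries a) (fun y => (y / (1 + c * y)) ^ 2)).
- now apply is_derive_PSeries.
- now apply is_derive_sqr_ratio.
Qed.

Section Derivatives.
Variables (n c x : R).
Hypothesis Hb : 0 < 1 + c * x.
Hypothesis Ht : Rbar_lt (Rabs ((x / (1 + c * x)) ^ 2)) (CV_radius (sqcoef n c)).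

Lemma is_derive_Ssum : is_derive (Ssum n c) x (dSsum n c x).
Proof.
assert (Hb' : 1 + c * x <> 0) by lra.
pose proof (is_derive_weight n c x Hb) as HG.
pose proof (is_derive_PSeries_sqr_ratio _ c x Hb' Ht) as HF.
pose proof (is_derive_mult _ _ _ _ _ HG HF Rmult_comm) as H.
eapply (is_derive_ext _ _ _ _ (fun _ => eq_refl)) in H.
unfold dSsum; cbv zeta; evar_last; [exact H |].
unfold plus, mult; simpl; field; exact Hb'.
Qed.

Lemma is_derive_dSsum : is_derive (dSsum n c) x (ddSsum n c x).
Proof.
assert (Hb' : 1 + c * x <> 0) by lra.
pose proof (is_derive_weight n c x Hb) as HG.
pose proof (is_derive_PSeries_sqr_ratio _ c x Hb' Ht) as HF.
assert (Ht1 := Ht); rewrite <- CV_radius_derive in Ht1.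
pose proof (is_derive_PSeries_sqr_ratio _ c x Hb' Ht1) as HF1.
assert (Ha : is_derive (fun y => - 2 * n / (1 + c * y)) x (2 * n * c / (1 + c * x) ^ 2))
  by (auto_derive; [exact Hb' | field; exact Hb']).
assert (Hd : is_derive (fun y => 2 * y / (1 + c * y) ^ 3) x
    (2 / (1 + c * x) ^ 3 - 6 * c * x / (1 + c * x) ^ 4))
  by (auto_derive; [repeat apply Rmult_integral_contrapositive_currified; lra
                   | field; exact Hb']).
pose proof (is_derive_mult _ _ _ _ _ HG
  (is_derive_plus _ _ _ _ _ (is_derive_mult _ _ _ _ _ Ha HF Rmult_comm)
     (is_derive_mult _ _ _ _ _ Hd HF1 Rmult_comm)) Rmult_comm) as H.
unfold ddSsum; cbv zeta; evar_last; [exact H |].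
unfold plus, mult; simpl; field; exact Hb'.
Qed.

Lemma Ssum_ode :
  x * (1 + c * x) * (1 + 2 * c * x) * ddSsum n c x
  + (4 * (n + c) * x * (1 + c * x) + 1) * dSsum n c x
  + 2 * n * (1 + 2 * c * x) * Ssum n c x = 0.
Proof.
pose proof (PSeries_sqcoef_ode n c _ Ht) as H.
unfold Ssum, dSsum, ddSsum; cbv zeta.
set (F := PSeries (sqcoef n c) _) in *.
set (F1 := PSeries (PS_derive (sqcoef n c)) _) in *.
set (F2 := PSeries _ _) in *.
(* The factor comes from comparing the terms in [F'']: [t (1 - c^2 t) = x^2 (1 + 2 c x) / (1 + c
   x)^4], whereas the linear equation carries [4 x^3 (1 + 2 c x) / (1 + c x)^5]. *)
match type of H with ?e = 0 => transitivity (weight n c x * (4 * x / (1 + c * x)) * e) end.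
- field; lra.
- rewrite H; ring.
Qed.
End Derivatives.

(** At the singular point the Riccati equation gives [u 0] only; the value of [u'] there is computed
    from this second derivative. *)
Lemma ddSsum_0 (n c : R) : ddSsum n c 0 = 6 * n ^ 2 + 2 * n * c.
Proof.
unfold ddSsum; cbv zeta; rewrite weight_0.
replace ((0 / (1 + c * 0)) ^ 2) with 0 by (field; lra).
rewrite !PSeries_0; unfold PS_derive, sqcoef; simpl; field; lra.
Qed.

(** * Radius of convergence and positivity of the sum *)

Lemma is_series_finite (a : nat -> R) (l : nat) :
  (forall k, (l < k)%nat -> a k = 0) -> is_series a (sum_n a l).
Proof.
intros Ha; change (is_lim_seq (sum_n a) (sum_n a l)).
apply (is_lim_seq_ext_loc (fun _ => sum_n a l)); [| apply is_lim_seq_const].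
exists l; intros k Hk; induction Hk as [| k Hk IH]; [easy |].
rewrite sum_Sn, <- IH, Ha by lia; symmetry; apply Rplus_0_r.
Qed.

Lemma CV_radius_finite (a : nat -> R) (l : nat) :
  (forall k, (l < k)%nat -> a k = 0) -> CV_radius a = p_infty.
Proof.
intros Ha.
assert (H : forall r : R, Rbar_le r (CV_radius a)).
{ intros r; apply (proj1 (Lub_Rbar_correct (CV_disk a))).
  eexists; apply (is_series_finite _ l).
  intros k Hk; rewrite Ha, Rmult_0_l by exact Hk; apply Rabs_R0. }
destruct (CV_radius a) as [z | |]; [| easy |].
- specialize (H (z + 1)); simpl in H; lra.
- now specialize (H 0).
Qed.

Lemma rcoef_pos (n c : R) (k : nat) : 0 < n -> 0 <= c -> 0 < rcoef n c k.
Proof.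
intros Hn Hc; induction k as [|k IH]; [simpl; lra |].
change (rcoef n c (S k)) with (rcoef n c k * (n + c * INR k) / INR (S k)).
pose proof (pos_INR k); pose proof (lt_0_INR (S k) ltac:(lia)).
apply Rdiv_lt_0_compat; [apply Rmult_lt_0_compat; nra | easy].
Qed.

Lemma rcoef_terminates (c : R) (l k : nat) : (l < k)%nat -> rcoef (- c * INR l) c k = 0.
Proof.
intros Hk; induction Hk as [| k Hk IH].
- change (rcoef (- c * INR l) c (S l)) with
    (rcoef (- c * INR l) c l * (- c * INR l + c * INR l) / INR (S l)).
  unfold Rdiv; ring.
- change (rcoef (- c * INR l) c (S k)) with
    (rcoef (- c * INR l) c k * (- c * INR l + c * INR k) / INR (S k)).
  rewrite IH; unfold Rdiv; ring.
Qed.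

Lemma rcoef_pos_neg (c : R) (l k : nat) :
  c < 0 -> (k <= l)%nat -> 0 < rcoef (- c * INR l) c k.
Proof.
intros Hc; induction k as [|k IH]; intros Hk; [simpl; lra |].
change (rcoef (- c * INR l) c (S k)) with
  (rcoef (- c * INR l) c k * (- c * INR l + c * INR k) / INR (S k)).
pose proof (lt_0_INR (S k) ltac:(lia)); pose proof (lt_INR k l ltac:(lia)).
specialize (IH ltac:(lia)).
apply Rdiv_lt_0_compat; [apply Rmult_lt_0_compat; nra | easy].
Qed.

Lemma sqcoef_ratio_lim (n c : R) :
  0 < n -> 0 <= c ->
  is_lim_seq (fun k => Rabs (sqcoef n c (S k) / sqcoef n c k)) (c ^ 2).
Proof.
intros Hn Hc.
(* [(n + c k) / (k + 1) = (n - c) / (k + 1) + c] exhibits the ratio as a continuous function of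
   [1 / (k + 1)]. *)
apply (is_lim_seq_ext (fun k => ((n - c) * / INR (S k) + c) ^ 2)).
{ intros k.
  pose proof (rcoef_pos n c k Hn Hc).
  pose proof (INR_S_neq_0 k) as Hk.
  replace (sqcoef n c (S k) / sqcoef n c k) with (((n - c) * / INR (S k) + c) ^ 2).
  - symmetry; apply Rabs_pos_eq, pow2_ge_0.
  - unfold sqcoef; change (rcoef n c (S k)) with (rcoef n c k * (n + c * INR k) / INR (S k)).
    rewrite S_INR in Hk |- *; field; split; [exact Hk | lra]. }
replace (Finite (c ^ 2)) with (Finite (((n - c) * 0 + c) ^ 2)) by (f_equal; ring).
apply (is_lim_seq_continuous (fun y => ((n - c) * y + c) ^ 2)).
- apply continuity_pt_filterlim, (ex_derive_continuous (fun y => ((n - c) * y + c) ^ 2)).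
  auto_derive; easy.
- apply (is_lim_seq_inv _ p_infty); [| easy].
  apply is_lim_seq_incr_1 with (u := INR); apply is_lim_seq_INR.
Qed.

(** The radius is infinite for [c = 0] and [1 / c^2] otherwise; in the latter case [1 - c^2 t = (1 +
    2 c x) / (1 + c x)^2 > 0]. *)
Lemma sqcoef_radius (n c x : R) :
  0 < n -> 0 <= c -> 0 < 1 + 2 * c * x -> 0 < 1 + c * x ->
  Rbar_lt (Rabs ((x / (1 + c * x)) ^ 2)) (CV_radius (sqcoef n c)).
Proof.
intros Hn Hc Hx Hb.
assert (Ha : forall k, sqcoef n c k <> 0)
  by (intros k; apply pow_nonzero, Rgt_not_eq, rcoef_pos; assumption).
pose proof (sqcoef_ratio_lim n c Hn Hc) as Hl.
destruct (Req_dec c 0) as [-> | Hc0].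
- rewrite (CV_radius_infinite_DAlembert _ Ha); [easy |].
  now replace (Finite 0) with (Finite (0 ^ 2)) by (f_equal; ring).
- assert (0 < c ^ 2) by (apply pow_lt; lra).
  rewrite (CV_radius_finite_DAlembert _ (c ^ 2) Ha ltac:(assumption) Hl).
  change (Rabs ((x / (1 + c * x)) ^ 2) < / c ^ 2).
  rewrite Rabs_pos_eq by apply pow2_ge_0.
  apply (Rmult_lt_reg_l (c ^ 2)); [easy |].
  rewrite Rinv_r by lra.
  replace (c ^ 2 * (x / (1 + c * x)) ^ 2) with (1 - (1 + 2 * c * x) / (1 + c * x) ^ 2)
    by (field; lra).
  assert (0 < (1 + 2 * c * x) / (1 + c * x) ^ 2)
    by (apply Rdiv_lt_0_compat; [| apply pow_lt]; assumption).
  lra.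
Qed.

(** The constant term of the series is 1, and the others are nonnegative because the coefficients
    and [t] are squares. *)
Lemma Ssum_pos (n c x : R) :
  Rbar_lt (Rabs ((x / (1 + c * x)) ^ 2)) (CV_radius (sqcoef n c)) -> 0 < Ssum n c x.
Proof.
intros Ht; unfold Ssum; apply Rmult_lt_0_compat; [apply weight_pos |].
set (t := (x / (1 + c * x)) ^ 2) in *.
assert (H0 : 0 <= t) by apply pow2_ge_0.
rewrite PSeries_decr_1 by (apply CV_radius_inside; exact Ht).
assert (H : 0 <= PSeries (PS_decr_1 (sqcoef n c)) t).
{ rewrite <- (PSeries_const_0 t); apply Series_le.
  - intros k; rewrite Rmult_0_l; split; [lra |].
    apply Rmult_le_pos; [apply pow2_ge_0 | now apply pow_le].
  - apply ex_pseries_R, CV_radius_inside; rewrite CV_radius_decr_1; exact Ht. }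
pose proof (Rmult_le_pos _ _ H0 H); replace (sqcoef n c 0) with 1 by (unfold sqcoef; simpl; ring).
lra.
Qed.

Lemma is_derive_continuous (f : R -> R) (x d : R) : is_derive f x d -> continuous f x.
Proof. intros Hf; apply (ex_derive_continuous f); now exists d. Qed.

(** * Twice continuously differentiable functions *)

(** The closed form divides by [1 + c * x], so at [x = - 1 / c] the derivatives are those of a
    polynomial; continuity of the second one carries the equation to that point. *)
Definition C2 (f : R -> R) : Prop :=
  exists f1 f2 : R -> R,
    (forall x, is_derive f x (f1 x)) /\ (forall x, is_derive f1 x (f2 x)) /\
    (forall x, continuous f2 x).

Lemma C2_ext (f g : R -> R) : (forall x, f x = g x) -> C2 f -> C2 g.
Proof.
intros E (f1 & f2 & Hf & Hf1 & Hf2); exists f1, f2; split; [| now split].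
intros x; now apply (is_derive_ext f).
Qed.

Lemma C2_affine (a b : R) : C2 (fun x => a + b * x).
Proof.
exists (fun _ => b), (fun _ => 0); (split; [| split]); intros x.
- auto_derive; [easy | ring].
- auto_derive; easy.
- apply continuous_const.
Qed.

Lemma C2_id : C2 (fun x => x).
Proof. apply (C2_ext (fun x => 0 + 1 * x)); [intros; ring | apply C2_affine]. Qed.

Lemma C2_plus (f g : R -> R) : C2 f -> C2 g -> C2 (fun x => f x + g x).
Proof.
intros (f1 & f2 & Hf & Hf1 & Hf2) (g1 & g2 & Hg & Hg1 & Hg2).
exists (fun x => f1 x + g1 x), (fun x => f2 x + g2 x); (split; [| split]); intros x.
- now apply (is_derive_plus f g).
- now apply (is_derive_plus f1 g1).
- now apply (continuous_plus f2 g2).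
Qed.

Lemma C2_mult (f g : R -> R) : C2 f -> C2 g -> C2 (fun x => f x * g x).
Proof.
intros (f1 & f2 & Hf & Hf1 & Hf2) (g1 & g2 & Hg & Hg1 & Hg2).
exists (fun x => f1 x * g x + f x * g1 x),
  (fun x => (f2 x * g x + f1 x * g1 x) + (f1 x * g1 x + f x * g2 x)); (split; [| split]); intros x.
- now apply (is_derive_mult f g); [ | | apply Rmult_comm].
- apply (is_derive_plus (fun y => f1 y * g y) (fun y => f y * g1 y));
    [apply (is_derive_mult f1 g) | apply (is_derive_mult f g1)]; easy || apply Rmult_comm.
- apply (continuous_plus (fun y => f2 y * g y + f1 y * g1 y)
    (fun y => f1 y * g1 y + f y * g2 y));
  [apply (continuous_plus (fun y => f2 y * g y) (fun y => f1 y * g1 y))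
  |apply (continuous_plus (fun y => f1 y * g1 y) (fun y => f y * g2 y))];
  [apply (continuous_mult f2 g) | apply (continuous_mult f1 g1)
  |apply (continuous_mult f1 g1) | apply (continuous_mult f g2)]; eauto using is_derive_continuous.
Qed.

Lemma C2_const (a : R) : C2 (fun _ => a).
Proof. apply (C2_ext (fun x => a + 0 * x)); [intros; ring | apply C2_affine]. Qed.

Lemma C2_pow (f : R -> R) (k : nat) : C2 f -> C2 (fun x => f x ^ k).
Proof.
intros Hf; induction k as [|k IH]; [exact (C2_const 1) | now apply (C2_mult f)].
Qed.

Lemma C2_sum_n (f : nat -> R -> R) (l : nat) :
  (forall k, C2 (f k)) -> C2 (fun x => sum_n (fun k => f k x) l).
Proof.
intros Hf; induction l as [|l IH].
- apply (C2_ext (f 0%nat)); [intros x; now rewrite sum_O | apply Hf].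
- apply (C2_ext (fun x => sum_n (fun k => f k x) l + f (S l) x)).
  + intros x; now rewrite sum_Sn.
  + now apply C2_plus.
Qed.

(** * The case [c < 0]: [S] as a polynomial *)

(** With [n = - c l] the weight is [(1 + c x)^(2 l)], which clears every denominator
    [(1 + c x)^(2 k)], [k <= l]; the subtraction [l - k] never truncates. *)
Definition binom_poly (c : R) (l : nat) (x : R) : R :=
  sum_n (fun k => sqcoef (- c * INR l) c k * x ^ (2 * k)
                  * (1 + c * x) ^ (2 * (l - k))) l.

Lemma C2_binom_poly (c : R) (l : nat) : C2 (binom_poly c l).
Proof.
apply C2_sum_n; intros k.
apply C2_mult; [apply C2_mult; [apply C2_const |] |]; apply C2_pow; [apply C2_id | apply C2_affine].
Qed.

Lemma gpow_INR (b : R) (k : nat) : 0 <= b -> gpow b (INR k) = b ^ k.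
Proof.
intros Hb; unfold gpow; destruct (Rlt_dec 0 b) as [H | H]; [now apply Rpower_pow |].
replace b with 0 by lra.
destruct (Req_EM_T (INR k) 0) as [E | E].
- now rewrite (INR_eq k 0 E).
- rewrite pow_i; [easy |]; destruct k; [now destruct E | lia].
Qed.

(** Beyond [l] the coefficient vanishes, whatever [gpow] returns at negative exponents; up to [l]
    the exponents are natural numbers, so the end point is included. *)
Lemma Snc_binom_poly (c : R) (l : nat) (x : R) :
  c < 0 -> 0 <= 1 + c * x -> Snc (- c * INR l) c x = binom_poly c l x.
Proof.
intros Hc Hb; unfold Snc; apply is_series_unique.
set (n := - c * INR l).
assert (Hp : forall k, pnk n c k x =
    rcoef n c k * x ^ k * gpow (1 + c * x) (INR l - INR k)).
{ intros k; rewrite (pnk_rcoef n c k x) by lra; do 2 f_equal; unfold n; field; lra. }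
replace (binom_poly c l x) with (sum_n (fun k => pnk n c k x ^ 2) l).
- apply is_series_finite; intros k Hk.
  rewrite Hp; unfold n; rewrite rcoef_terminates by exact Hk; ring.
- apply sum_n_ext_loc; intros k Hk.
  rewrite Hp, <- minus_INR, gpow_INR, !pow_mult by assumption; unfold sqcoef; fold n.
  match goal with |- ?a = ?b => change (@eq R a b) end.
  rewrite <- !pow_mult, !(Nat.mul_comm 2), !pow_mult; ring.
Qed.

Lemma sum_n_nonneg (f : nat -> R) (l : nat) : (forall k, 0 <= f k) -> 0 <= sum_n f l.
Proof.
intros Hf; induction l as [|l IH]; [now rewrite sum_O |].
rewrite sum_Sn; now apply Rplus_le_le_0_compat.
Qed.

Lemma sum_n_ge_last (f : nat -> R) (l : nat) : (forall k, 0 <= f k) -> f l <= sum_n f l.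
Proof.
intros Hf; destruct l as [|l]; [rewrite sum_O; apply Rle_refl |].
pose proof (sum_n_nonneg f l Hf).
rewrite sum_Sn; change (f (S l) <= sum_n f l + f (S l)); lra.
Qed.

Lemma Ssum_binom_poly (c : R) (l : nat) (x : R) :
  c < 0 -> 0 < 1 + c * x -> Ssum (- c * INR l) c x = binom_poly c l x.
Proof.
intros Hc Hb; rewrite <- Snc_binom_poly by lra; symmetry; now apply Snc_weight.
Qed.

Lemma sqcoef_radius_neg (c : R) (l : nat) :
  CV_radius (sqcoef (- c * INR l) c) = p_infty.
Proof.
apply (CV_radius_finite _ l); intros k Hk.
unfold sqcoef; rewrite rcoef_terminates by exact Hk; ring.
Qed.

Lemma binom_poly_pos (c : R) (l : nat) (x : R) :
  c < 0 -> 0 <= 1 + c * x -> 0 < binom_poly c l x.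
Proof.
intros Hc [Hb | Hb].
- rewrite <- Ssum_binom_poly by assumption; apply Ssum_pos.
  now rewrite sqcoef_radius_neg.
- unfold binom_poly; rewrite <- Hb.
  eapply Rlt_le_trans; [| apply sum_n_ge_last].
  + rewrite Nat.sub_diag, Nat.mul_0_r, pow_mult; simpl (0 ^ 0); rewrite Rmult_1_r.
    apply Rmult_lt_0_compat; [apply pow_lt, rcoef_pos_neg; [exact Hc | lia] |].
    apply pow_lt, pow2_gt_0; nra.
  + intros k; rewrite !pow_mult; apply Rmult_le_pos; [apply Rmult_le_pos |];
      [apply pow2_ge_0 | |]; apply pow_le, pow2_ge_0.
Qed.

Lemma locally_1cx (c x : R) : 0 < 1 + c * x -> locally x (fun y => 0 < 1 + c * y).
Proof.
intros Hx; apply (open_comp (fun y => 1 + c * y) (fun z => 0 < z)); [| apply open_gt | exact Hx].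
intros y _; apply (ex_derive_continuous (fun y => 1 + c * y)); auto_derive; easy.
Qed.

(** Where [1 + c * x > 0] the polynomial coincides locally with [Ssum], so uniqueness of derivatives
    transports [Ssum_ode]; the end point follows by a limit. *)
Lemma binom_poly_ode (c : R) (l : nat) :
  c < 0 -> exists T1 T2 : R -> R,
    forall x, 0 <= 1 + c * x ->
      is_derive (binom_poly c l) x (T1 x) /\ is_derive T1 x (T2 x) /\
      x * (1 + c * x) * (1 + 2 * c * x) * T2 x
      + (4 * (- c * INR l + c) * x * (1 + c * x) + 1) * T1 x
      + 2 * (- c * INR l) * (1 + 2 * c * x) * binom_poly c l x = 0.
Proof.
intros Hc; destruct (C2_binom_poly c l) as (T1 & T2 & H1 & H2 & Hcont).
exists T1, T2; intros x Hx; split; [apply H1 |]; split; [apply H2 |].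
set (n := - c * INR l).
assert (Hrad : forall y, Rbar_lt (Rabs ((y / (1 + c * y)) ^ 2)) (CV_radius (sqcoef n c)))
  by (intros y; unfold n; now rewrite sqcoef_radius_neg).
assert (E1 : forall y, 0 < 1 + c * y -> dSsum n c y = T1 y).
{ intros y Hy; rewrite <- (is_derive_unique _ _ _ (H1 y)); symmetry; apply is_derive_unique.
  apply (is_derive_ext_loc (Ssum n c)); [| now apply is_derive_Ssum].
  eapply filter_imp; [| apply (locally_1cx c y Hy)].
  intros z Hz; now apply Ssum_binom_poly. }
assert (E2 : forall y, 0 < 1 + c * y -> ddSsum n c y = T2 y).
{ intros y Hy; rewrite <- (is_derive_unique _ _ _ (H2 y)); symmetry; apply is_derive_unique.
  apply (is_derive_ext_loc (dSsum n c)); [| now apply is_derive_dSsum].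
  eapply filter_imp; [exact E1 | apply (locally_1cx c y Hy)]. }
set (E := fun x => x * (1 + c * x) * (1 + 2 * c * x) * T2 x
      + (4 * (n + c) * x * (1 + c * x) + 1) * T1 x
      + 2 * n * (1 + 2 * c * x) * binom_poly c l x).
assert (HE : forall y, 0 < 1 + c * y -> E y = 0).
{ intros y Hy; unfold E; rewrite <- E1, <- E2, <- Ssum_binom_poly by assumption.
  now apply Ssum_ode. }
change (E x = 0).
destruct Hx as [Hx | Hx]; [now apply HE |].
assert (HEc : continuous E x).
{ unfold E.
  assert (HT : continuous (binom_poly c l) x) by exact (is_derive_continuous _ _ _ (H1 x)).
  assert (HT1 : continuous T1 x) by exact (is_derive_continuous _ _ _ (H2 x)).
  apply (continuous_plus (fun x => x * (1 + c * x) * (1 + 2 * c * x) * T2 x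
      + (4 * (n + c) * x * (1 + c * x) + 1) * T1 x)
      (fun x => 2 * n * (1 + 2 * c * x) * binom_poly c l x));
  [apply (continuous_plus (fun x => x * (1 + c * x) * (1 + 2 * c * x) * T2 x)
      (fun x => (4 * (n + c) * x * (1 + c * x) + 1) * T1 x)) |].
  - apply (continuous_mult (fun x => x * (1 + c * x) * (1 + 2 * c * x)) T2); [| apply Hcont].
    apply (ex_derive_continuous (fun x => x * (1 + c * x) * (1 + 2 * c * x))); auto_derive; easy.
  - apply (continuous_mult (fun x => 4 * (n + c) * x * (1 + c * x) + 1) T1); [| exact HT1].
    apply (ex_derive_continuous (fun x => 4 * (n + c) * x * (1 + c * x) + 1)); auto_derive; easy.
  - apply (continuous_mult (fun x => 2 * n * (1 + 2 * c * x)) (binom_poly c l)); [| exact HT].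
    apply (ex_derive_continuous (fun x => 2 * n * (1 + 2 * c * x))); auto_derive; easy. }
(* Here [1 + c * x = 0] and [c < 0], so every [y < x] satisfies [1 + c * y > 0]; the radius 1 below
   is arbitrary. *)
apply (filterlim_locally_unique (F := at_left x) E).
- now apply (filterlim_filter_le_1 E (filter_le_within _)).
- apply (filterlim_ext_loc (fun _ => 0)); [| apply filterlim_const].
  exists (mkposreal 1 Rlt_0_1); intros y _ Hy; symmetry; apply HE; nra.
Qed.

(** * A barrier principle on the half-line *)

Lemma continuous_pos_near (f : R -> R) (x : R) :
  continuous f x -> 0 < f x -> exists d, 0 < d /\ forall y, Rabs (y - x) < d -> 0 < f y.
Proof.
intros Hf Hx; destruct (Hf (fun y => 0 < y) (open_gt 0 _ Hx)) as [d Hd].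
exists d; split; [apply cond_pos | exact Hd].
Qed.

Lemma derive_pos_near_zero (f : R -> R) (x d : R) :
  is_derive f x d -> f x = 0 -> 0 < d ->
  exists e, 0 < e /\ forall h, 0 < h < e -> f (x - h) < 0 < f (x + h).
Proof.
intros Hf H0 Hd; apply is_derive_Reals in Hf.
destruct (Hf d Hd) as [e He]; exists e; split; [apply cond_pos |].
intros h Hh.
assert (K : forall k, k <> 0 -> Rabs k < e -> 0 < f (x + k) / k).
{ intros k Hk Hke; specialize (He k Hk Hke); rewrite H0, Rminus_0_r in He.
  apply Rabs_def2 in He; lra. }
split.
- specialize (K (- h)); rewrite Rabs_Ropp, Rabs_pos_eq in K by lra.
  specialize (K ltac:(lra) ltac:(lra)).
  replace (f (x - h)) with (- h * (f (x + - h) / - h)) by (unfold Rminus; field; lra).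
  nra.
- specialize (K h); rewrite Rabs_pos_eq in K by lra.
  specialize (K ltac:(lra) ltac:(lra)).
  replace (f (x + h)) with (h * (f (x + h) / h)) by (field; lra).
  nra.
Qed.

(** A function can only reach zero from above with a nonpositive slope. The start [f 0 = 0] is
    allowed, since the slope there is then positive. *)
Lemma barrier (f df : R -> R) :
  (forall x, 0 <= x -> is_derive f x (df x)) ->
  0 <= f 0 ->
  (forall x, 0 <= x -> f x = 0 -> 0 < df x) ->
  forall x, 0 < x -> 0 < f x.
Proof.
intros Hd H0 Hz x Hx; apply Rnot_le_lt; intros Hneg.
assert (Hright : forall s, 0 <= s -> 0 <= f s ->
  exists e, 0 < e /\ forall y, s < y < s + e -> 0 < f y).
{ intros s Hs [Hpos | Hs0].
  - destruct (continuous_pos_near f s) as (e & He & Hy);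
      [now apply (is_derive_continuous _ _ (df s)), Hd | exact Hpos |].
    exists e; split; [exact He |]; intros y Hye; apply Hy, Rabs_def1; lra.
  - destruct (derive_pos_near_zero f s (df s)) as (e & He & Hy); auto.
    exists e; split; [exact He |]; intros y Hye.
    replace y with (s + (y - s)) by ring; apply Hy; lra. }
(* Positivity is required only for [0 < y] because [f 0] may vanish; [0] lies in [E] vacuously. *)
set (E := fun s => 0 <= s <= x /\ forall y, 0 < y < s -> 0 < f y).
destruct (completeness E) as [s [Hub Hlub]].
{ exists x; intros s Hs; apply Hs. }
{ exists 0; split; [lra |]; intros y Hy; lra. }
assert (Hs0 : 0 <= s) by (apply Hub; split; [lra | intros y Hy; lra]).
assert (Hsx : s <= x) by (apply Hlub; intros z Hz'; apply Hz').
assert (HsE : forall y, 0 < y < s -> 0 < f y).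
{ intros y Hy; apply Rnot_le_lt; intros Hfy.
  apply (Rlt_irrefl s), (Rle_lt_trans _ y); [| lra].
  apply Hlub; intros z [_ Hz']; apply Rnot_lt_le; intros Hyz.
  specialize (Hz' y); lra. }
(* A negative value at [s] would persist to its left by continuity, and a zero would force negative
   values there by its positive slope; both contradict [HsE]. *)
assert (Hfs : 0 < s -> 0 <= f s /\ (f s = 0 -> False)).
{ intros Hs; split.
  - apply Rnot_lt_le; intros Hfs.
    destruct (continuous_pos_near (fun y => - f y) s) as (e & He & Hy).
    + apply (continuous_opp f), (is_derive_continuous _ _ (df s)), Hd; lra.
    + lra.
    + set (h := Rmin (e / 2) (s / 2)).
      assert (0 < h) by (apply Rmin_pos; lra).
      assert (h <= e / 2) by apply Rmin_l; assert (h <= s / 2) by apply Rmin_r.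
      specialize (Hy (s - h)); rewrite Rabs_minus_sym, Rabs_pos_eq in Hy by lra.
      specialize (HsE (s - h)); lra.
  - intros Hfs.
    destruct (derive_pos_near_zero f s (df s)) as (e & He & Hy); auto.
    set (h := Rmin (e / 2) (s / 2)).
    assert (0 < h) by (apply Rmin_pos; lra).
    assert (h <= e / 2) by apply Rmin_l; assert (h <= s / 2) by apply Rmin_r.
    specialize (Hy h); specialize (HsE (s - h)); lra. }
assert (Hfs0 : 0 <= f s) by (destruct Hs0 as [Hs0 | <-]; [now apply Hfs | exact H0]).
assert (Hsx' : s < x).
{ destruct Hsx as [Hsx | ->]; [exact Hsx |]; exfalso; apply Hfs; lra. }
destruct (Hright s Hs0 Hfs0) as (e & He & Hy).
set (h := Rmin (e / 2) (x - s)).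
assert (0 < h) by (apply Rmin_pos; lra).
assert (h <= e / 2) by apply Rmin_l; assert (h <= x - s) by apply Rmin_r.
(* Positivity extends to [s + h], past the supremum. *)
enough (s + h <= s) by lra.
apply Hub; split; [lra |]; intros y Hyh.
destruct (Rlt_le_dec y s) as [Hys | [Hys | <-]].
- apply HsE; lra.
- apply Hy; lra.
- destruct Hfs0 as [? | E0]; [assumption |]; exfalso; apply Hfs; lra.
Qed.

(** * Comparison arguments for the Riccati equation *)

Section Riccati.
Variables (n c : R) (u du : R -> R).
Hypotheses (Hn : 0 < n) (Hc : 0 <= c) (Hcn : c < n).
Hypothesis Hu : forall x, 0 <= x -> is_derive u x (du x).
Hypothesis Hric : forall x, 0 <= x ->
  x * (1 + c * x) * (1 + 2 * c * x) * du x =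
  x * (1 + c * x) * (1 + 2 * c * x) * u x ^ 2
  - (4 * (n + c) * x * (1 + c * x) + 1) * u x + 2 * n * (1 + 2 * c * x).
Hypothesis Hdu_0 : du 0 = - 2 * n * (n + c).

Lemma riccati_0 : u 0 = 2 * n.
Proof. pose proof (Hric 0 (Rle_refl 0)); lra. Qed.

Lemma riccati_coef_pos (x : R) : 0 < x -> 0 < x * (1 + c * x) * (1 + 2 * c * x).
Proof. intros Hx; repeat apply Rmult_lt_0_compat; nra. Qed.

Lemma riccati_pos (x : R) : 0 <= x -> 0 < u x.
Proof.
intros [Hx | <-]; [| rewrite riccati_0; lra].
apply (barrier u du); [exact Hu | rewrite riccati_0; lra | | exact Hx].
clear x Hx; intros x [Hx | <-] E; [| rewrite riccati_0 in E; lra].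
pose proof (riccati_coef_pos x Hx) as Hp; pose proof (Hric x (Rlt_le _ _ Hx)) as H.
rewrite E in H; apply (Rmult_lt_reg_l _ _ _ Hp); rewrite H.
assert (0 < 2 * n * (1 + 2 * c * x)) by (repeat apply Rmult_lt_0_compat; nra).
lra.
Qed.

(* [2n / (1 + 2cx)] is a supersolution agreeing with [u] at [0]; this is where [c < n] is used. *)
Lemma riccati_upper (x : R) : 0 < x -> u x < 2 * n / (1 + 2 * c * x).
Proof.
intros Hx.
enough (H : 0 < 2 * n / (1 + 2 * c * x) - u x) by lra.
apply (barrier (fun y => 2 * n / (1 + 2 * c * y) - u y)
  (fun y => - 4 * n * c / (1 + 2 * c * y) ^ 2 - du y)); [| | | exact Hx].
- intros y Hy; apply (is_derive_minus (fun y => 2 * n / (1 + 2 * c * y)) u); [| now apply Hu].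
  auto_derive; [nra | field; nra].
- rewrite riccati_0; apply Req_le; field.
- clear x Hx; intros x [Hx | <-] E.
  + pose proof (riccati_coef_pos x Hx) as Hp; pose proof (Hric x (Rlt_le _ _ Hx)) as H.
    assert (Hw : 0 < 1 + 2 * c * x) by nra.
    apply (Rmult_lt_reg_l _ _ _ Hp); rewrite Rmult_0_r, Rmult_minus_distr_l, H.
    replace (u x) with (2 * n / (1 + 2 * c * x)) by lra.
    match goal with |- 0 < ?e =>
      (* The simplification rests on [(1 + 2 c x)^2 = 1 + 4 c x (1 + c x)]. *)
      replace e with (4 * n * (n - c) * (x * (1 + c * x)) / (1 + 2 * c * x)) by (field; lra) end.
    apply Rdiv_lt_0_compat; [| exact Hw].
    repeat apply Rmult_lt_0_compat; nra.
  (* Both functions equal [2 n] at 0; their slopes differ by [2 n (n - c) > 0]. *)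
  + rewrite Hdu_0; replace (- 4 * n * c / (1 + 2 * c * 0) ^ 2) with (- 4 * n * c) by field; nra.
Qed.

Lemma riccati_decr (x : R) : 0 <= x -> du x < 0.
Proof.
intros [Hx | <-]; [| rewrite Hdu_0; nra].
pose proof (riccati_coef_pos x Hx) as Hp; pose proof (Hric x (Rlt_le _ _ Hx)) as H.
set (p y := y * (1 + c * y) * (1 + 2 * c * y)).
set (q y := 4 * (n + c) * y * (1 + c * y) + 1).
set (r y := 2 * n * (1 + 2 * c * y)).
set (dp y := 1 + 6 * c * y * (1 + c * y)).
set (dq y := 4 * (n + c) * (1 + 2 * c * y)).
(* The barrier function is [- p u']. *)
enough (0 < q x * u x - p x * u x ^ 2 - r x) by (unfold p, q, r in *; nra).
apply (barrier (fun y => q y * u y - p y * u y ^ 2 - r y)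
  (fun y => dq y * u y + q y * du y - dp y * u y ^ 2 - 2 * p y * u y * du y - 4 * n * c));
  [| | | exact Hx].
- intros y Hy; unfold q, p, r, dq, dp; pose proof (Hu y Hy) as Hd.
  assert (He : ex_derive u y) by now exists (du y).
  auto_derive; [easy |]; 
  rewrite (is_derive_unique (fun z : R => u z) y (du y) Hd); ring.
- unfold p, q, r; rewrite riccati_0; lra.
- clear x Hx Hp H; intros x [Hx | <-] E.
  + pose proof (riccati_coef_pos x Hx) as Hp; pose proof (Hric x (Rlt_le _ _ Hx)) as H.
    assert (Hdu : du x = 0).
    { apply (Rmult_eq_reg_l (x * (1 + c * x) * (1 + 2 * c * x))); [| lra].
      rewrite H; unfold p, q, r in E; lra. }
    rewrite Hdu.
    pose proof (riccati_pos x (Rlt_le _ _ Hx)) as Hv.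
    pose proof (riccati_upper x Hx) as Hvw.
    assert (Hw : 0 < 1 + 2 * c * x) by nra.
    apply (Rmult_lt_compat_r _ _ _ Hw) in Hvw.
    replace (2 * n / (1 + 2 * c * x) * (1 + 2 * c * x)) with (2 * n) in Hvw by (field; lra).
    (* In these variables [p = X w] and [w^2 = 1 + 4 c X], and the upper bound becomes [z < 2 n],
       which puts [z] below the vertex of the quadratic [Ez]. *)
    set (w := 1 + 2 * c * x) in *; set (X := x * (1 + c * x)); set (z := u x * w) in *.
    assert (HX : 0 < X) by (apply Rmult_lt_0_compat; nra).
    assert (Hw2 : w ^ 2 = 1 + 4 * c * X) by (unfold w, X; ring).
    assert (Hz : 0 < z) by (apply Rmult_lt_0_compat; assumption).
    assert (Ez : X * z ^ 2 - (4 * (n + c) * X + 1) * z + 2 * n * w ^ 2 = 0).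
    { transitivity (- w * (q x * u x - p x * u x ^ 2 - r x)); [| rewrite E; ring].
      unfold q, p, r, z; fold w; unfold X; ring. }
    (* [z] is the smaller root of this quadratic, so [z ^ 2] is at most the product of the roots. *)
    assert (Hroot : X * z ^ 2 < 2 * n * w ^ 2).
    { assert (2 * X * z < 4 * (n + c) * X + 1) by nra. nra. }
    (* This is [X w^2] times the slope of the barrier function at its zero. Modulo [Ez] and [Hw2] it
       equals [w^2 (2 n - z) + 2 c X (2 n w^2 - X z^2)], whose signs are given by the upper bound
       and [Hroot]. *)
    assert (Hlast : 0 < X * (4 * (n + c) * z * w ^ 2 - (1 + 6 * c * X) * z ^ 2 - 4 * n * c * w ^ 2)).
    { replace (X * (4 * (n + c) * z * w ^ 2 - (1 + 6 * c * X) * z ^ 2 - 4 * n * c * w ^ 2))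
        with (w ^ 2 * (2 * n - z) + 2 * c * X * (2 * n * w ^ 2 - X * z ^ 2)
          - w ^ 2 * (X * z ^ 2 - (4 * (n + c) * X + 1) * z + 2 * n * w ^ 2)
          + (X * z ^ 2 + 2 * n * w ^ 2) * (w ^ 2 - (1 + 4 * c * X))) by ring.
      rewrite Ez, Hw2, Rminus_diag, Rmult_0_r, Rmult_0_r, Rminus_0_r, Rplus_0_r, <- Hw2.
      apply Rplus_lt_le_0_compat; [apply Rmult_lt_0_compat; [now apply pow_lt | lra] |].
      apply Rmult_le_pos; [apply Rmult_le_pos; lra | lra]. }
    apply (Rmult_lt_reg_l (X * w ^ 2)); [apply Rmult_lt_0_compat; [exact HX | now apply pow_lt] |].
    rewrite Rmult_0_r; eapply Rlt_le_trans; [exact Hlast |]; apply Req_le.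
    unfold z, dq, dp, w, X; ring.
  (* The slope at 0 is [- p'(0) u'(0) = 2 n (n + c)]. *)
  + rewrite Hdu_0, riccati_0; unfold dq, dp, q, p; nra.
Qed.
End Riccati.

(** * From the linear equation to the Riccati equation on [Ic] *)

Lemma is_derive_within_intro (D : R -> Prop) (f g : R -> R) (x d : R) :
  (forall y, D y -> f y = g y) -> D x -> is_derive g x d -> is_derive_within D f x d.
Proof.
intros Hfg Hx Hg; apply is_derive_Reals in Hg.
intros P [e He]; destruct (Hg e (cond_pos e)) as [d' Hd].
exists d'; intros h Hh [Hh0 HD]; apply He.
rewrite (Hfg x Hx), (Hfg _ HD); apply Hd; [exact Hh0 |].
revert Hh; unfold ball; simpl; unfold AbsRing_ball, abs, minus, plus, opp; simpl.
now rewrite Ropp_0, Rplus_0_r.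
Qed.

Lemma is_derive_log_derivative (s s1 : R -> R) (x d : R) :
  0 < s x -> is_derive s x (s1 x) -> is_derive s1 x d ->
  is_derive (fun y => - ln (s y)) x (- s1 x / s x) /\
  is_derive (fun y => - s1 y / s y) x (- d / s x + (- s1 x / s x) ^ 2).
Proof.
intros Hpos Hs Hs1.
assert (Es : ex_derive s x) by now exists (s1 x).
assert (Es1 : ex_derive s1 x) by now exists d.
split.
- auto_derive; [now repeat split |].
  rewrite (is_derive_unique (fun z : R => s z) x _ Hs); field; lra.
- auto_derive; [repeat split; try easy; lra |].
  rewrite (is_derive_unique (fun z : R => s z) x _ Hs),
    (is_derive_unique (fun z : R => s1 z) x _ Hs1); field; lra.
Qed.

Lemma riccati_of_linear (n c x s s1 s2 : R) :
  s <> 0 ->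
  x * (1 + c * x) * (1 + 2 * c * x) * s2
  + (4 * (n + c) * x * (1 + c * x) + 1) * s1 + 2 * n * (1 + 2 * c * x) * s = 0 ->
  x * (1 + c * x) * (1 + 2 * c * x) * (- s2 / s + (- s1 / s) ^ 2) =
  x * (1 + c * x) * (1 + 2 * c * x) * (- s1 / s) ^ 2
  - (4 * (n + c) * x * (1 + c * x) + 1) * (- s1 / s) + 2 * n * (1 + 2 * c * x).
Proof.
intros Hs H; apply Rminus_diag_uniq.
match type of H with ?e = 0 => transitivity (- e / s) end; [field; exact Hs |].
rewrite H; field; exact Hs.
Qed.

(** Common to both signs of [c]: [s] is two-sidedly differentiable even at the end points of [Ic],
    while [Snc] has to agree with it only on [Ic]. *)
Lemma riccati_within (n c : R) (s s1 s2 : R -> R) :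
  (forall x, Ic c x ->
     Snc n c x = s x /\ 0 < s x /\ is_derive s x (s1 x) /\ is_derive s1 x (s2 x) /\
     x * (1 + c * x) * (1 + 2 * c * x) * s2 x
     + (4 * (n + c) * x * (1 + c * x) + 1) * s1 x + 2 * n * (1 + 2 * c * x) * s x = 0) ->
  exists u u' : R -> R,
    forall x, Ic c x ->
      is_derive_within (Ic c) (Rnc n c) x (u x) /\
      is_derive_within (Ic c) u x (u' x) /\
      x * (1 + c * x) * (1 + 2 * c * x) * u' x =
        x * (1 + c * x) * (1 + 2 * c * x) * (u x) ^ 2
        - (4 * (n + c) * x * (1 + c * x) + 1) * u x
        + 2 * n * (1 + 2 * c * x).
Proof.
intros H.
exists (fun x => - s1 x / s x), (fun x => - s2 x / s x + (- s1 x / s x) ^ 2); intros x Hx.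
destruct (H x Hx) as (_ & Hpos & Hs & Hs1 & Hode).
destruct (is_derive_log_derivative s s1 x (s2 x) Hpos Hs Hs1) as [HR Hu].
split; [| split].
- apply (is_derive_within_intro _ _ (fun y => - ln (s y))); [| exact Hx | exact HR].
  intros y Hy; unfold Rnc; f_equal; f_equal; apply (H y Hy).
- now apply (is_derive_within_intro _ _ (fun x => - s1 x / s x)).
- apply riccati_of_linear; [lra | exact Hode].
Qed.

(** * Concavity and monotonicity from the derivative *)

Lemma increment_derive (f df : R -> R) (x y : R) :
  0 <= x -> x <= y -> (forall z, 0 <= z -> is_derive f z (df z)) ->
  exists z, x <= z <= y /\ f y - f x = df z * (y - x).
Proof.
intros Hx Hxy Hf.
destruct (MVT_gen f x y df) as (z & Hz & E);
  rewrite ?Rmin_left, ?Rmax_right in * by exact Hxy.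
- intros z Hz; apply Hf; lra.
- intros z Hz; apply continuity_pt_filterlim, (is_derive_continuous f z (df z)), Hf; lra.
- now exists z.
Qed.

(** The mean value theorem on both sides of the intermediate point gives two slopes, the left one at
    least the right one; exchanging the points and [t] with [1 - t] reduces to [x <= y]. *)
Lemma concave_of_derive_decr (f df : R -> R) :
  (forall x, 0 <= x -> is_derive f x (df x)) ->
  (forall x y, 0 <= x -> x <= y -> df y <= df x) ->
  forall x y t, 0 <= x -> 0 <= y -> 0 <= t <= 1 ->
    t * f x + (1 - t) * f y <= f (t * x + (1 - t) * y).
Proof.
intros Hf Hdf.
assert (W : forall x y t, 0 <= x -> x <= y -> 0 <= t <= 1 ->
    t * f x + (1 - t) * f y <= f (t * x + (1 - t) * y)).
{ intros x y t Hx Hxy Ht; set (z := t * x + (1 - t) * y).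
  assert (Hxz : z - x = (1 - t) * (y - x)) by (unfold z; ring).
  assert (Hzy : y - z = t * (y - x)) by (unfold z; ring).
  assert (0 <= (1 - t) * (y - x)) by (apply Rmult_le_pos; lra).
  assert (0 <= t * (y - x)) by (apply Rmult_le_pos; lra).
  destruct (increment_derive f df x z) as (a & Ha & Ea); [exact Hx | lra | exact Hf |].
  destruct (increment_derive f df z y) as (b & Hb & Eb); [lra | lra | exact Hf |].
  rewrite Hxz in Ea; rewrite Hzy in Eb.
  pose proof (Hdf a b ltac:(lra) ltac:(lra)) as Hab.
  assert (0 <= t * (1 - t) * (y - x) * (df a - df b))
    by (repeat apply Rmult_le_pos; lra).
  assert (t * (f z - f x) - (1 - t) * (f y - f z) = t * (1 - t) * (y - x) * (df a - df b))
    by (rewrite Ea, Eb; ring).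
  lra. }
intros x y t Hx Hy Ht; destruct (Rle_or_lt x y) as [H | H]; [now apply W |].
pose proof (W y x (1 - t) Hy ltac:(lra) ltac:(lra)) as H'.
replace (1 - (1 - t)) with t in H' by ring.
rewrite (Rplus_comm (t * x)); lra.
Qed.

Lemma increasing_of_derive_pos (f df : R -> R) :
  (forall x, 0 <= x -> is_derive f x (df x)) -> (forall x, 0 <= x -> 0 < df x) ->
  forall x y, 0 <= x -> x < y -> f x < f y.
Proof.
intros Hf Hdf x y Hx Hxy.
destruct (increment_derive f df x y) as (z & Hz & E); [exact Hx | lra | exact Hf |].
pose proof (Rmult_lt_0_compat _ _ (Hdf z ltac:(lra)) (proj2 (Rlt_0_minus _ _) Hxy)); lra.
Qed.

(** * The case [0 <= c] and the conclusion *)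

Lemma Snc_nonneg_param (n c x : R) :
  0 < n -> 0 <= c -> 0 <= x ->
  Snc n c x = Ssum n c x /\ 0 < Ssum n c x /\
  is_derive (Ssum n c) x (dSsum n c x) /\ is_derive (dSsum n c) x (ddSsum n c x) /\
  x * (1 + c * x) * (1 + 2 * c * x) * ddSsum n c x
  + (4 * (n + c) * x * (1 + c * x) + 1) * dSsum n c x
  + 2 * n * (1 + 2 * c * x) * Ssum n c x = 0.
Proof.
intros Hn Hc Hx.
assert (Hb : 0 < 1 + c * x) by nra.
pose proof (sqcoef_radius n c x Hn Hc ltac:(nra) Hb) as Ht.
split; [| split; [| split; [| split]]].
- now apply Snc_weight.
- now apply Ssum_pos.
- now apply is_derive_Ssum.
- now apply is_derive_dSsum.
- now apply Ssum_ode.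
Qed.

Lemma Rnc_concave_increasing (n c : R) :
  0 < n -> 0 <= c -> c < n ->
  (forall x y t, 0 <= x -> 0 <= y -> 0 <= t <= 1 ->
     t * Rnc n c x + (1 - t) * Rnc n c y <= Rnc n c (t * x + (1 - t) * y)) /\
  (forall x y, 0 <= x -> x < y -> Rnc n c x < Rnc n c y).
Proof.
intros Hn Hc Hcn.
set (f x := - ln (Ssum n c x)); set (u x := - dSsum n c x / Ssum n c x).
set (du x := - ddSsum n c x / Ssum n c x + u x ^ 2).
assert (E : forall x, 0 <= x -> Rnc n c x = f x)
  by (intros x Hx; unfold Rnc; now rewrite (proj1 (Snc_nonneg_param n c x Hn Hc Hx))).
assert (Hf : forall x, 0 <= x -> is_derive f x (u x) /\ is_derive u x (du x)).
{ intros x Hx; destruct (Snc_nonneg_param n c x Hn Hc Hx) as (_ & Hpos & H1 & H2 & _).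
  now apply is_derive_log_derivative. }
assert (Hu : forall x, 0 <= x -> is_derive u x (du x)) by (intros x Hx; now apply Hf).
assert (Hric : forall x, 0 <= x ->
  x * (1 + c * x) * (1 + 2 * c * x) * du x =
  x * (1 + c * x) * (1 + 2 * c * x) * u x ^ 2
  - (4 * (n + c) * x * (1 + c * x) + 1) * u x + 2 * n * (1 + 2 * c * x)).
{ intros x Hx; destruct (Snc_nonneg_param n c x Hn Hc Hx) as (_ & Hpos & _ & _ & Hode).
  apply riccati_of_linear; [lra | exact Hode]. }
assert (Ssum_0 : Ssum n c 0 = 1).
{ unfold Ssum; rewrite weight_0; replace ((0 / (1 + c * 0)) ^ 2) with 0 by (field; lra).
  rewrite PSeries_0; unfold sqcoef; simpl; ring. }
assert (Hdu0 : du 0 = - 2 * n * (n + c)).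
{ unfold du; rewrite (riccati_0 n c u du Hric), ddSsum_0, Ssum_0; field. }
split.
- intros x y t Hx Hy Ht; rewrite !E by nra.
  apply (concave_of_derive_decr f u); try assumption; [intros z Hz; now apply Hf |].
  intros a b Ha Hab.
  destruct (increment_derive u du a b Ha Hab Hu) as (z & Hz & Ez).
  pose proof (riccati_decr n c u du Hn Hc Hcn Hu Hric Hdu0 z ltac:(lra)) as Hdu.
  assert (0 <= (- du z) * (b - a)) by (apply Rmult_le_pos; lra); lra.
- intros x y Hx Hxy; rewrite !E by lra.
  apply (increasing_of_derive_pos f u); try assumption; [intros z Hz; now apply Hf |].
  intros z Hz; now apply (riccati_pos n c u du).
Qed.

Theorem theorem4p1 (n c : R) (Hnc : admissible n c) :
  (0 <= c ->
     (forall x y t, 0 <= x -> 0 <= y -> 0 <= t <= 1 ->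
        t * Rnc n c x + (1 - t) * Rnc n c y <= Rnc n c (t * x + (1 - t) * y)) /\
     (forall x y, 0 <= x -> x < y -> Rnc n c x < Rnc n c y)) /\
  (exists u u' : R -> R,
     forall x, Ic c x ->
       is_derive_within (Ic c) (Rnc n c) x (u x) /\
       is_derive_within (Ic c) u x (u' x) /\
       x * (1 + c * x) * (1 + 2 * c * x) * u' x =
         x * (1 + c * x) * (1 + 2 * c * x) * (u x) ^ 2
         - (4 * (n + c) * x * (1 + c * x) + 1) * u x
         + 2 * n * (1 + 2 * c * x)).
Proof.
destruct Hnc as (Hn & Hcn & Hl); split.
- intros Hc; apply Rnc_concave_increasing; auto.
- destruct (Rle_or_lt 0 c) as [Hc | Hc].
  + apply (riccati_within n c (Ssum n c) (dSsum n c) (ddSsum n c)).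
    intros x [Hx _]; now apply Snc_nonneg_param.
  + destruct (Hl Hc) as [l ->]; destruct (binom_poly_ode c l Hc) as (T1 & T2 & HT).
    apply (riccati_within _ c (binom_poly c l) T1 T2).
    intros x [_ Hx]; specialize (Hx Hc).
    assert (Hb : 0 <= 1 + c * x).
    { apply (Rmult_le_compat_neg_l c) in Hx; [| lra].
      replace (c * (- 1 / c)) with (-1) in Hx by (field; lra); lra. }
    split; [now apply Snc_binom_poly |].
    split; [now apply binom_poly_pos | now apply HT].
Qed.
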